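(* For every pair of integers $k,g\ge 0$ there exists a (nonzero) integer $m=m(g,k)$ which annihilates the torsion subgroup of the magnitude cohomology $\mathrm{MH}^k_*(G;\mathbb Z)=\bigoplus_{l}\mathrm{MH}^k_l(G;\mathbb Z)$ for every finite quiver $G$ of genus at most $g$.
   Context: A (finite) quiver $G$ consists of finite sets $V(G)$ (vertices), $E(G)$ (edges) and maps $s,t\colon E(G)\to V(G)$ (source, target). The genus of $G$ is the first Betti number of its geometric realization (the 1-dimensional CW complex with 0-cells the vertices and 1-cells the edges). Magnitude cohomology. For vertices $v,w$ of $G$, $d(v,w)$ is the minimal number of edges of a directed path from $v$ to $w$ ($d(v,v)=0$, and $d(v,w)=\infty$ if there is no directed path). For a tuple $(v_0,\dots,v_k)$ with $v_i\ne v_{i+1}$ and $d(v_i,v_{i+1})<\infty$ for all $i$, put $\ell(v_0,\dots,v_k)=\sum_{i=0}^{k-1}d(v_i,v_{i+1})$. $\mathrm{MC}_{k,l}(G;\mathbb Z)$ is the free abelian group on such tuples with $\ell(v_0,\dots,v_k)=l$, with differential $\delta=\sum_{i=1}^{k-1}(-1)^i\delta_i\colon\mathrm{MC}_{k,l}\to\mathrm{MC}_{k-1,l}$, where $\delta_i(v_0,\dots,v_k)=(v_0,\dots,v_{i-1},v_{i+1},\dots,v_k)$ if this tuple has length $l$ (and no two equal consecutive entries), and $0$ otherwise. $\mathrm{MH}^k_l(G;\mathbb Z)$ is the $k$-th cohomology of the dual cochain complex $\mathrm{Hom}(\mathrm{MC}_{*,l}(G;\mathbb Z),\mathbb Z)$.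 *)

(* Defs.v *)
From HB Require Import structures.
From mathcomp Require Import all_boot all_order all_algebra.
From mathcomp Require Import boolp.

Set Implicit Arguments.
Unset Strict Implicit.
Unset Printing Implicit Defensive.

Import GRing.Theory.
Local Open Scope ring_scope.

(* The free R-module on a finite set X, as the module of all functions X -> R;
   fbasis x is the basis vector of x and flinear f the linear extension of f. *)
Notation freemod R X := {ffun X -> R^o}.

Definition fbasis (R : nzRingType) (X : finType) (x : X) : freemod R X :=
  [ffun y => (y == x)%:R].

Definition flinear (R : comNzRingType) (X : finType) (V : lmodType R)
  (f : X -> V) (c : freemod R X) : V := \sum_x c x *: f x.

Lemma flinear_is_linear (R : comNzRingType) (X : finType) (V : lmodType R)
  (f : X -> V) : linear (flinear f).
Proof.
move=> a u v; rewrite /flinear scaler_sumr -big_split /=.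
by apply: eq_bigr => x _; rewrite !ffunE scalerDl scalerA.
Qed.

HB.instance Definition _ (R : comNzRingType) (X : finType) (V : lmodType R)
  (f : X -> V) :=
  GRing.isLinear.Build R (freemod R X) V _ (flinear f) (flinear_is_linear f).

Lemma flinear_fbasis (R : comNzRingType) (X : finType) (V : lmodType R)
  (f : X -> V) (x : X) : flinear f (fbasis R x) = f x.
Proof.
rewrite /flinear (bigD1 x) //= ffunE eqxx scale1r big1 ?addr0 // => y yx.
by rewrite ffunE (negPf yx) scale0r.
Qed.

Record quiver := Quiver {
  vert : finType;
  edge : finType;
  src : edge -> vert;
  tgt : edge -> vert
}.

(* The boundary map of the cellular chain complex (with rational coefficients)
   of the realization of G; its kernel is the first homology, as there are no
   2-cells. *)
Definition boundary (G : quiver) :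
    'Hom(freemod rat (edge G), freemod rat (vert G)) :=
  linfun (flinear (fun e => fbasis rat (tgt e) - fbasis rat (src e))).

Definition genus (G : quiver) : nat := \dim (lker (boundary G)).

Fixpoint dpath (G : quiver) (v : vert G) (p : seq (edge G)) (w : vert G)
    : bool :=
  if p is e :: p' then (src e == v) && dpath (tgt e) p' w else v == w.

Definition has_dpath (G : quiver) (v w : vert G) (n : nat) : bool :=
  [exists p : n.-tuple (edge G), dpath v p w].

(* None stands for an infinite distance. *)
Definition dist (G : quiver) (v w : vert G) : option nat :=
  match pselect (exists n, has_dpath v w n) with
  | left vw => Some (ex_minn vw)
  | right _ => None
  end.

(* A tuple (v_0, .., v_k) has type k.+1.-tuple, and its consecutive pairs are
   indexed by i : 'I_k through widen_ord and lift ord0, of values i and i.+1.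
   The value 0 used for infinite distances is irrelevant: the length is only
   considered for admissible tuples. *)
Definition mlength (G : quiver) (k : nat) (x : k.+1.-tuple (vert G)) : nat :=
  (\sum_(i < k)
    odflt 0 (dist (tnth x (widen_ord (leqnSn k) i)) (tnth x (lift ord0 i))))%N.

Definition admissible (G : quiver) (k : nat) (x : k.+1.-tuple (vert G))
    : bool :=
  [forall i : 'I_k,
     let v := tnth x (widen_ord (leqnSn k) i) in
     let w := tnth x (lift ord0 i) in
     (v != w) && isSome (dist v w)].

Definition mtuple (G : quiver) (k l : nat) : finType :=
  {x : k.+1.-tuple (vert G) | admissible x && (mlength x == l)}.

Definition MC (G : quiver) (k l : nat) : vectType int :=
  freemod int (mtuple G k l).

Definition omit (T : Type) (k : nat) (i : 'I_k.+2) (x : k.+2.-tuple T)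
    : k.+1.-tuple T :=
  [tuple tnth x (lift i j) | j < k.+1].

(* insub returns None, and the face is 0, when the shorter tuple has a length
   other than l (or is not admissible). *)
Definition mface (G : quiver) (k l : nat) (i : 'I_k.+2)
    (x : mtuple G k.+1 l) : MC G k l :=
  if insub (omit i (val x)) is Some y then fbasis int (y : mtuple G k l) else 0.

(* The indices i of the sum are those of the interior entries of the k.+2-tuple
   x = (v_0, .., v_k.+1). *)
Definition mdiff (G : quiver) (k l : nat) : 'Hom(MC G k.+1 l, MC G k l) :=
  linfun (flinear (fun x : mtuple G k.+1 l =>
    \sum_(i < k.+2 | (0 < i < k.+1)%N) (-1) ^+ i *: mface i x)).

Definition cochain (G : quiver) (k l : nat) := 'Hom(MC G k l, int^o).
HB.instance Definition _ (G : quiver) (k l : nat) :=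
  GRing.Zmodule.on (cochain G k l).

Definition codiff (G : quiver) (k l : nat) (f : cochain G k l)
    : cochain G k.+1 l := (f \o mdiff G k l)%VF.

Lemma codiffB (G : quiver) (k l : nat) (f g : cochain G k l) :
  codiff (f - g) = codiff f - codiff g.
Proof. by rewrite /codiff comp_lfunDl comp_lfunNl. Qed.

HB.instance Definition _ (G : quiver) (k l : nat) :=
  GRing.isZmodMorphism.Build (cochain G k l) (cochain G k.+1 l)
    (@codiff G k l) (@codiffB G k l).

Definition cocycle (G : quiver) (k l : nat) : {pred cochain G k l} :=
  fun f => codiff f == 0.

Lemma cocycle_zmod_closed (G : quiver) (k l : nat) :
  zmod_closed (@cocycle G k l).
Proof.
split=> [|f g]; rewrite /cocycle !unfold_in ?raddf0 // => /eqP f0 /eqP g0.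
by rewrite codiffB f0 g0 subrr.
Qed.

HB.instance Definition _ (G : quiver) (k l : nat) :=
  GRing.isZmodClosed.Build (cochain G k l) (@cocycle G k l)
    (@cocycle_zmod_closed G k l).

Record cocycles (G : quiver) (k l : nat) := Cocycle {
  cocycle_val :> cochain G k l;
  cocycle_valP : cocycle_val \in @cocycle G k l
}.
HB.instance Definition _ (G : quiver) (k l : nat) :=
  [isSub for @cocycle_val G k l].
HB.instance Definition _ (G : quiver) (k l : nat) :=
  [Choice of cocycles G k l by <:].
HB.instance Definition _ (G : quiver) (k l : nat) :=
  [SubChoice_isSubZmodule of cocycles G k l by <:].

(* In degree 0 the only coboundary is 0, since the complex vanishes in degree
   -1. *)
Definition is_coboundary (G : quiver) (k l : nat) : cochain G k l -> Prop :=
  match k with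
  | 0 => fun f => f = 0
  | k'.+1 => fun f => exists h : cochain G k' l, f = codiff h
  end.

(* As a predicate on cocycles; since two successive differentials compose to 0
   this is no restriction. *)
Definition coboundary (G : quiver) (k l : nat) : {pred cocycles G k l} :=
  fun f => `[< is_coboundary (f : cochain G k l) >].

Lemma coboundary_zmod_closed (G : quiver) (k l : nat) :
  zmod_closed (@coboundary G k l).
Proof.
case: k => [|k]; split=> [|f g]; rewrite /coboundary !unfold_in /=.
- exact/asboolP.
- by move=> /asboolP f0 /asboolP g0; apply/asboolP; rewrite f0 g0 subrr.
- by apply/asboolP; exists 0; rewrite raddf0.
- move=> /asboolP[a fa] /asboolP[b gb]; apply/asboolP.
  by exists (a - b); rewrite codiffB -fa -gb.
Qed.

HB.instance Definition _ (G : quiver) (k l : nat) :=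
  GRing.isZmodClosed.Build (cocycles G k l) (@coboundary G k l)
    (@coboundary_zmod_closed G k l).

Definition MHl (G : quiver) (k l : nat) : zmodType :=
  Quotient.quot (@coboundary G k l).

Section DirectSum.
Variable M : nat -> zmodType.

Definition dprod : Type := forall l, M l.
HB.instance Definition _ := Choice.on dprod.
Implicit Types x y z : dprod.

Let zero : dprod := fun l => 0.
Let opp x : dprod := fun l => - x l.
Let add x y : dprod := fun l => x l + y l.

Fact dprod_addA : associative add.
Proof. by move=> x y z; apply: functional_extensionality_dep => l; exact: addrA. Qed.
Fact dprod_addC : commutative add.
Proof. by move=> x y; apply: functional_extensionality_dep => l; exact: addrC. Qed.
Fact dprod_add0 : left_id zero add.
Proof. by move=> x; apply: functional_extensionality_dep => l; exact: add0r. Qed.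
Fact dprod_addN : left_inverse zero opp add.
Proof. by move=> x; apply: functional_extensionality_dep => l; exact: addNr. Qed.
HB.instance Definition _ :=
  GRing.isZmodule.Build dprod dprod_addA dprod_addC dprod_add0 dprod_addN.

Definition finsupp : {pred dprod} :=
  fun x => `[< exists N, forall l, (N <= l)%N -> x l = 0 >].

Lemma finsupp_zmod_closed : zmod_closed finsupp.
Proof.
split=> [|x y]; rewrite /finsupp !unfold_in.
  by apply/asboolP; exists 0.
move=> /asboolP[a xa] /asboolP[b yb]; apply/asboolP; exists (maxn a b) => l.
rewrite geq_max => /andP[al bl]; rewrite -[LHS]/(x l - y l).
by rewrite xa // yb // subrr.
Qed.
HB.instance Definition _ :=
  GRing.isZmodClosed.Build dprod finsupp finsupp_zmod_closed.

Record dsum := Dsum { dsum_val :> dprod; dsum_valP : dsum_val \in finsupp }.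
HB.instance Definition _ := [isSub for dsum_val].
HB.instance Definition _ := [Choice of dsum by <:].
HB.instance Definition _ := [SubChoice_isSubZmodule of dsum by <:].

End DirectSum.

Definition MH (G : quiver) (k : nat) : zmodType := dsum (MHl G k).

Definition torsion (A : zmodType) (x : A) : Prop :=
  exists2 n : int, n != 0 & x *~ n = 0.

(* Main.v *)
Require Import Defs.
From HB Require Import structures.
From mathcomp Require Import all_boot all_order all_algebra.
From mathcomp Require Import generic_quotient ring_quotient boolp ring zify.

Set Implicit Arguments.
Unset Strict Implicit.
Unset Printing Implicit Defensive.

Import GRing.Theory.
Local Open Scope quotient_scope.
Local Open Scope ring_scope.

(** Fix the endpoints [x] and [y] of the tuples.  Only the vertices on directed
    walks from [x] to [y] occur, and by rank-nullity the number of edges between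
    them exceeds their number by at most the genus [g].  As each of them has an
    outgoing edge (except possibly [y]) and an incoming one (except possibly
    [x]), all but [2g+4] of them have a single outgoing edge, whose target is
    not [y].  Such a vertex [v], with successor [v'], can be discarded without
    changing the cohomology: on the tuples that contain [v], filtered by the
    number of occurrences of [v], inserting [v'] right after the last [v] is a
    contracting homotopy, as every walk leaving [v] passes through [v'].
    Discarding these vertices one by one leaves at most [2g+4] points, hence
    finitely many possible differentials in degree [k], and the Smith normal
    form bounds the torsion for each of them. *)

(** * The codifferential on functions of words *)

Section Cobd.
Variables (T : eqType) (smooth : T -> T -> T -> bool).
Implicit Types (phi psi : seq T -> int) (s : seq T) (u v w : T).

(* [cobd phi s] is the sum over the interior entries of [s] of the signed values
   of [phi] on the word obtained by deleting that entry, restricted to those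
   entries for which [smooth] holds of their neighbourhood; the recursion splits
   off the deletion of the first interior entry. *)
Fixpoint cobd phi s : int :=
  if s is u :: s1 then
    if s1 is v :: w :: t then
      - ((smooth u v w)%:R * phi (u :: w :: t)) - cobd (fun r => phi (u :: r)) s1
    else 0
  else 0.

Lemma cobdE phi u v w t :
  cobd phi [:: u, v, w & t] = - ((smooth u v w)%:R * phi (u :: w :: t))
    - cobd (fun r => phi (u :: r)) [:: v, w & t].
Proof. by []. Qed.

Lemma eq_in_cobd phi psi s :
    (forall r, ohead r = ohead s -> size s = (size r).+1 -> subseq r s ->
       phi r = psi r) ->
  cobd phi s = cobd psi s.
Proof.
elim: s phi psi => [//|u [//|v [//|w t]]] IH phi psi e; rewrite !cobdE e //; last first.
  by rewrite -cat1s -(cat1s u [:: v, w & t]) cat_subseq // subseq_cons.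
rewrite (IH _ (fun r => psi (u :: r))) // => -[//|a r] hr [sr] ss; apply: e => //.
  by rewrite /= sr.
by rewrite -cat1s -(cat1s u [:: v, w & t]) cat_subseq.
Qed.

Lemma cobd0 s : cobd (fun=> 0) s = 0.
Proof.
by elim: s => [//|u [//|v [//|w t]]] IH; rewrite cobdE IH mulr0 oppr0 subr0.
Qed.

Lemma cobd_lin a phi psi s :
  cobd (fun r => a * phi r + psi r) s = a * cobd phi s + cobd psi s.
Proof.
elim: s phi psi => [|u [|v [|w t]] IH] phi psi; rewrite /= ?mulr0 ?addr0 //.
by move: (IH (fun r => phi (u :: r)) (fun r => psi (u :: r))) => /= ->; ring.
Qed.

Lemma cobdZ a phi s : cobd (fun r => a * phi r) s = a * cobd phi s.
Proof.
rewrite -[RHS]addr0 -(cobd0 s) -cobd_lin.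
by apply: eq_in_cobd => r _ _ _; rewrite addr0.
Qed.

(** Interior deletions keep the head, so a factor that depends on the head alone is a constant. *)
Lemma cobd_head (c : T -> int) phi u s :
  cobd (fun r => c (head u r) * phi r) (u :: s) = c u * cobd phi (u :: s).
Proof.
by rewrite -cobdZ; apply: eq_in_cobd => -[|b r] //= [->] _ _.
Qed.

Lemma cobd2 phi u v : cobd phi [:: u; v] = 0.
Proof. by []. Qed.

End Cobd.

Arguments cobd : simpl never.

(** * Words in a finite quasi-metric space *)

Section Metric.
Variables (V : finType) (d : V -> V -> option nat).

Definition add_option (a b : option nat) : option nat :=
  if a is Some x then if b is Some y then Some (x + y)%N else None else None.

Hypothesis d0 : forall u v, d u v = Some 0%N -> u = v.
Hypothesis dd : forall u, d u u = Some 0%N.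
Hypothesis dtri : forall u v w a b, d u v = Some a -> d v w = Some b ->
  exists2 c, d u w = Some c & (c <= a + b)%N.

Definition adj u v := (u != v) && isSome (d u v).
(** For adjacent letters: [v] lies on a geodesic from [u] to [w], so deleting it preserves the
    length. *)
Definition smooth u v w := d u w == add_option (d u v) (d v w).

Lemma adjP u v : adj u v -> exists2 a, d u v = Some a.+1 & u != v.
Proof.
move=> /andP[uv]; case E: (d u v) => [[|a]|] // _; last by exists a.
by rewrite (d0 E) eqxx in uv.
Qed.

Lemma smooth_adj u v w : adj u v -> adj v w -> smooth u v w -> adj u w.
Proof.
move=> /adjP[a ea _] /adjP[b eb _]; rewrite /smooth ea eb /= => /eqP ec.
by rewrite /adj ec andbT; apply/eqP => uw; move: ec; rewrite uw dd.
Qed.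

(** By the triangle inequality, both sides say that [d u z] is the sum of the three distances
    between consecutive letters. *)
Lemma smooth_assoc u v w z : adj u v -> adj v w -> adj w z ->
  smooth u v w && smooth u w z = smooth v w z && smooth u v z.
Proof.
move=> /adjP[a ea _] /adjP[b eb _] /adjP[c ec _].
have [p ep lp] := dtri ea eb; have [q eq lq] := dtri eb ec.
have [r er lr] := dtri ep ec; have [r' er' lr'] := dtri ea eq.
move: er'; rewrite er => -[rr].
rewrite /smooth ea eb ec ep eq er /=.
have eS m n : (Some m == Some n) = (m == n) by [].
rewrite !eS; subst; apply/idP/idP => /andP[/eqP H1 /eqP H2].
  by apply/andP; split; apply/eqP; lia.
by apply/andP; split; apply/eqP; lia.
Qed.

Local Notation cobd := (cobd smooth).
Local Notation word s := (sorted adj s).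

(** Splitting off the head leaves, besides an inductive term, the double deletions that involve the
    first interior letter [v]. Those of [v] and [w] cancel by [smooth_assoc], the others because
    deletions of [v] and of a letter after [w] commute. *)
Lemma cobdK phi s : word s -> cobd (cobd phi) s = 0.
Proof.
elim: s phi => [//|u [//|v [//|w t]]] IH phi /= /andP[uv ws].
case: t IH ws => [|z t] IH ws.
  by rewrite cobdE !cobd2 mulr0 oppr0 subr0.
rewrite cobdE.
pose c a := (smooth u v a)%:R : int.
pose f r := phi (u :: r).
have -> : cobd (fun r => cobd phi (u :: r)) [:: v, w, z & t] =
   cobd (fun r => - 1 * (if r is a :: (b :: q) then
         (smooth u a b)%:R * phi (u :: b :: q) else 0) + - 1 * cobd f r) [:: v, w, z & t].
  by apply: eq_in_cobd => -[|a [|b r]] //= _ _ _; rewrite cobdE !mulN1r.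
rewrite cobd_lin cobdZ IH // mulr0 addr0 (cobdE _ _ v w z t).
have -> : cobd (fun r => if r is b :: q then (smooth u v b)%:R * phi (u :: b :: q)
    else 0) [:: w, z & t] = c w * cobd f [:: w, z & t].
  rewrite -cobd_head; apply: eq_in_cobd => -[|b r] //= [->] _ _.
rewrite (cobdE _ phi u w z t) -/f.
move: ws => /= /andP[vw /andP[wz _]].
have := smooth_assoc uv vw wz; rewrite /c.
by case: (smooth u v w); case: (smooth u w z); case: (smooth v w z);
  case: (smooth u v z) => //= _; ring.
Qed.


Section Valid.
Variables x y : V.

Definition valid (U : {set V}) s :=
  [&& word s, all (mem U) s, ohead s == Some x & last x s == y].

(** A deletion with nonzero coefficient leaves adjacent neighbours by [smooth_adj], and the
    endpoints never move. *)
Lemma eq_cobd_valid U phi psi s : valid U s ->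
    (forall r, valid U r -> size s = (size r).+1 -> phi r = psi r) ->
  cobd phi s = cobd psi s.
Proof.
case/and4P=> ws Us /eqP hs /eqP ls e.
(* The endpoints are phrased relative to [s], so that the induction can strip the head. *)
have {e} : forall r, word r -> all (mem U) r -> ohead r = ohead s ->
    last x r = last x s -> size s = (size r).+1 -> phi r = psi r.
  by move=> r wr Ur hr lr; apply: e; rewrite /valid wr Ur hr hs lr ls !eqxx.
elim: s phi psi {hs ls} ws Us => [//|u [//|v [//|w t]]] IH phi psi ws Us e.
have /and3P[uv vw wt] : [&& adj u v, adj v w & path adj w t] by [].
have /and4P[Uu Uv Uw Ut] : [&& u \in U, v \in U, w \in U & all (mem U) t] by [].
rewrite !cobdE; congr (- _ - _).
  case: (boolP (smooth u v w)) => [uvw|]; last by rewrite !mul0r.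
  rewrite e //=; first by rewrite (smooth_adj uv vw uvw).
  by rewrite Uu Uw.
apply: IH => [||[|a r] wr Ur // [av] lr [sr]]; rewrite /= ?vw ?Uv ?Uw //.
apply: e => //=; last by rewrite sr.
  by move: wr; rewrite av /= uv.
by move: Ur => /= ->; rewrite Uu.
Qed.

(* The torsion of the cohomology in cochain degree [k - 1], for words in [U]
   from [x] to [y]: a word of size [k] has degree [k - 1]. *)
Definition torsion_bound k (m : int) (U : {set V}) := forall F h (n : int), n != 0 ->
  (forall s, valid U s -> size s = k.+1 -> cobd F s = 0) ->
  (forall s, valid U s -> size s = k -> n * F s = cobd h s) ->
  exists h', forall s, valid U s -> size s = k -> m * F s = cobd h' s.

(** * The contracting homotopy that discards a vertex *)

Section Insertion.
Variables (U : {set V}) (v v' : V).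
Hypotheses (v'U : v' \in U) (v'v : v' != v) (v'y : v' != y) (vy : v != y).
Hypotheses (vv' : adj v v').
Hypothesis succ_v : forall z, z \in U -> z != v ->
  d v z = add_option (d v v') (d v' z).

(** The head is left free, because the inductions below strip letters from the front. *)
Definition word_to s := [&& word s, all (mem U) s & last v s == y].

(* The transpose of the map that inserts [v'] after the last [v], unless it is
   already there. *)
Fixpoint insert_succ (F : seq V -> int) s :=
  if s is u :: s1 then
    if v \in s1 then - insert_succ (fun r => F (u :: r)) s1
    else if (u == v) && (ohead s1 != Some v') then - F [:: v, v' & s1] else 0
  else 0.

Lemma insert_succ_lin a F G s :
  insert_succ (fun r => a * F r + G r) s = a * insert_succ F s + insert_succ G s.
Proof.
elim: s F G => [|u s IH] F G /=; first by rewrite mulr0 addr0.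
by case: ifP => _; [rewrite IH; ring | case: ifP => _; ring].
Qed.

Lemma insert_succ0 s : insert_succ (fun=> 0) s = 0.
Proof.
by elim: s => //= u s ->; rewrite oppr0 !if_same.
Qed.

Lemma word_to_cons u s : word_to (u :: s) -> s != [::] -> word_to s.
Proof.
rewrite /word_to => /and3P[w /andP[_ a] l]; case: s w a l => //= b s.
by move=> /andP[_ ->] -> ->.
Qed.

Lemma word_to_adj u w s : word_to [:: u, w & s] -> adj u w.
Proof. by case/and3P=> /= /andP[]. Qed.

Lemma word_toU u s : word_to (u :: s) -> u \in U.
Proof. by case/and3P=> _ /= /andP[]. Qed.

Lemma word_to_consI u w s : u \in U -> adj u w -> word_to (w :: s) ->
  word_to [:: u, w & s].
Proof. by rewrite /word_to /= => -> -> /and3P[-> -> ->]. Qed.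

Lemma adj_v' z : z \in U -> adj v z -> z != v' -> adj v' z.
Proof.
move=> zU /adjP[a ea vz] zv'; rewrite /adj eq_sym zv' /=.
move: ea; rewrite succ_v 1?eq_sym //.
by case: (d v v') => //= b; case: (d v' z).
Qed.

Lemma word_to_insert s : word_to (v :: s) -> ohead s != Some v' -> word_to [:: v, v' & s].
Proof.
case: s => [|w s] ok; first by move: ok; rewrite /word_to /= (negPf vy) !andbF.
have okws := word_to_cons ok isT => wv'.
apply: word_to_consI => //; first exact: word_toU ok.
apply: word_to_consI => //; apply: adj_v' => //; [exact: word_toU okws | exact: word_to_adj ok].
Qed.

(** By [word_to_insert], inserting [v'] into a word yields a word again. *)
Lemma eq_in_insert_succ F G s : word_to s ->
    (forall r, word_to r -> ohead r = ohead s -> size r = (size s).+1 -> F r = G r) ->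
  insert_succ F s = insert_succ G s.
Proof.
elim: s F G => [//|u s IH] F G ok e /=.
case: ifP => vs.
  have s0 : s != [::] by case: (s) vs.
  congr (- _); apply: IH => [|r okr hr sr]; first exact: word_to_cons ok s0.
  apply: e => //=; last by rewrite sr.
  case: s r hr okr ok {vs s0 sr} => [|w s] [|_ r] // [->] okr ok.
  by apply: word_to_consI => //; [exact: word_toU ok | exact: word_to_adj ok].
case: ifP => // /andP[/eqP uv sv']; rewrite e ?uv //; apply: word_to_insert => //.
by rewrite -uv.
Qed.

Lemma insert_succ_notin F s : v \notin s -> insert_succ F s = 0.
Proof.
by case: s => [//|u s]; rewrite inE negb_or eq_sym /= => /andP[/negPf-> /negPf->].
Qed.

Lemma insert_succ_in F u s : v \in s ->
  insert_succ F (u :: s) = - insert_succ (fun r => F (u :: r)) s.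
Proof. by move=> /= ->. Qed.

Lemma insert_succ_last F s : v \notin s ->
  insert_succ F (v :: s) = if ohead s != Some v' then - F [:: v, v' & s] else 0.
Proof. by move=> /= /negPf->; rewrite eqxx. Qed.

(* The other terms of the homotopy formula involve words with fewer [v]'s. *)
Lemma cobd_insert_succ F s : word_to s -> v \in s ->
    (forall r, (count_mem v r < count_mem v s)%N -> F r = 0) ->
  cobd (insert_succ F) s + insert_succ (cobd F) s = F s.
Proof.
elim: s F => [//|u s IH] F ok us low.
(* If [v] recurs after the head [u], the insertion takes place in the tail, where the induction
   hypothesis applies; the terms that delete the first interior letter [w] are compared through
   [psi]. *)
have [vs|vs] := boolP (v \in s).
  case: s vs IH ok us low => [//|w [|z t]] vs IH ok us low.
    move: vs ok; rewrite inE /word_to => /eqP <- /=.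
    by rewrite (negPf vy) !andbF.
  rewrite insert_succ_in // cobdE.
  pose Fu r := F (u :: r); rewrite -/Fu.
  have -> : cobd (fun r => insert_succ F (u :: r)) [:: w, z & t] =
      - 1 * cobd (insert_succ Fu) [:: w, z & t].
    rewrite -cobdZ; apply: eq_in_cobd => r _ _ _; rewrite mulN1r.
    have [vr|vr] := boolP (v \in r); first by rewrite insert_succ_in.
    (* The last [v] of the tail has been deleted; if [u] is [v], inserting after [u] gives a word
       with fewer [v] than the original, where [F] vanishes. *)
    rewrite [insert_succ Fu r]insert_succ_notin // oppr0.
    have [uv|uv] := eqVneq u v; last first.
      by rewrite insert_succ_notin // inE negb_or eq_sym uv.
    rewrite uv insert_succ_last //; case: ifP => // _; rewrite low ?oppr0 //=.
    move: (vs); rewrite -has_pred1 has_count => c.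
    move/count_memPn: vr => ->; rewrite uv eqxx (negPf v'v).
    by rewrite ltn_add2l.
  pose psi r := if r is a :: b :: q then (smooth u a b)%:R * F (u :: b :: q) else 0.
  have -> : insert_succ (fun r => cobd F (u :: r)) [:: w, z & t] =
      - 1 * insert_succ psi [:: w, z & t] + - 1 * insert_succ (cobd Fu) [:: w, z & t].
    transitivity (insert_succ (fun r => - 1 * psi r + (- 1 * cobd Fu r + 0)) [:: w, z & t]).
      apply: eq_in_insert_succ; first exact: word_to_cons ok isT.
      by move=> [|a [|b r]] // _ _ _; rewrite cobdE addr0 !mulN1r.
    by rewrite !insert_succ_lin insert_succ0 addr0.
  rewrite -[RHS]/(Fu [:: w, z & t]).
  have <- := IH Fu (word_to_cons ok isT) vs _; last first.
    by move=> r cr; apply: low; rewrite /= ltn_add2l.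
  suff -> : insert_succ psi [:: w, z & t] =
      (smooth u w z)%:R * insert_succ F [:: u, z & t] by ring.
  have okz := word_to_cons (word_to_cons ok isT) isT.
  have [vz|vz] := boolP (v \in z :: t).
    rewrite !(insert_succ_in _ _ vz) mulrN; congr (- _).
    rewrite -[RHS]addr0 -(insert_succ0 (z :: t)) -insert_succ_lin.
    by apply: eq_in_insert_succ => // -[|b r] // _ [->] _; rewrite addr0.
  (* Here [w] is the last [v], and deleting it after the insertion lowers the number of [v]. *)
  have wv : w = v by move: vs; rewrite inE (negPf vz) orbF => /eqP.
  have uv : u != v by have /adjP[_ _] := word_to_adj ok; rewrite wv.
  have nuz : v \notin [:: u, z & t] by rewrite inE negb_or eq_sym uv.
  rewrite (insert_succ_notin _ nuz) mulr0 wv insert_succ_last //.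
  case: ifP => // _; rewrite /psi low ?mulr0 ?oppr0 //.
  have /count_memPn-> : v \notin [:: u, v' & z :: t].
    by rewrite !(inE, negb_or) eq_sym uv eq_sym v'v -negb_or.
  by rewrite -has_count has_pred1.
have uv : u = v by move: us; rewrite inE (negPf vs) orbF => /eqP.
move: ok low; rewrite {}uv => ok low {us}.
case: s IH ok vs low => [|w s] IH ok vs low.
  by move: ok; rewrite /word_to /= (negPf vy) !andbF.
have vw := word_to_adj ok; have oks := word_to_cons ok isT.
have sm_v' z : z \in U -> z != v -> smooth v v' z.
  by move=> zU zv; rewrite /smooth succ_v.
(* The head is now the only [v]. If [v'] already follows it, only the deletion of [v'] survives, and
   insertion restores it. Otherwise [v'] is inserted, its deletion gives the value of [F], and the
   other terms cancel. *)
have [wv'|wv'] := eqVneq w v'.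
  rewrite insert_succ_last // wv' eqxx addr0.
  case: s IH ok vs low oks => [|z t] IH ok vs low oks.
    by move: oks; rewrite /word_to /= wv' (negPf v'y) !andbF.
  have okz := word_to_cons oks isT.
  move: vs; rewrite !inE !negb_or => /and3P[vw' vz vt].
  have zU := word_toU okz; have v'z := word_to_adj oks.
  rewrite cobdE sm_v' // 1?eq_sym // mul1r.
  have -> : cobd (fun r => insert_succ F (v :: r)) [:: v', z & t] = 0.
    rewrite -[RHS](cobd0 smooth [:: v', z & t]).
    apply: eq_in_cobd => -[|b r] // [->] _ /mem_subseq sub.
    rewrite insert_succ_last ?eqxx // (contra (sub v)) // !inE !negb_or eq_sym v'v vz.
    by [].
  rewrite subr0 insert_succ_last ?inE ?negb_or ?vz //.
  have /adjP[_ _ ] := v'z; rewrite wv' => nz.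
  rewrite ifT ?opprK //.
  by apply: contra nz => /eqP[->].
rewrite insert_succ_last //.
have -> : ohead (w :: s) != Some v' by apply: contra wv' => /eqP[->].
rewrite cobdE sm_v' ?(word_toU oks) //; last by case/adjP: vw; rewrite eq_sym.
rewrite mul1r opprB opprK addrA -[RHS]add0r; congr (_ + _).
case: s IH ok vs low oks => [|z t] IH ok vs low oks; first by rewrite !cobd2 addr0.
have okz := word_to_cons oks isT; have wz := word_to_adj oks; have zU := word_toU okz.
have wU := word_toU oks.
move: vs; rewrite !inE !negb_or => /and3P[vw' vz vt].
rewrite !cobdE.
have -> : cobd (fun r => insert_succ F (v :: r)) [:: w, z & t] =
    - 1 * cobd (fun r => F [:: v, v' & r]) [:: w, z & t].
  rewrite -cobdZ; apply: eq_in_cobd => -[|b r] // [->] _ /mem_subseq sub.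
  rewrite insert_succ_last ?(contra (sub v)) ?inE ?negb_or ?vw' ?vz //.
  have -> : ohead (w :: r) != Some v' by apply: contra wv' => /eqP[->].
  by rewrite mulN1r.
rewrite insert_succ_last ?inE ?negb_or ?vz // .
(* If [z] is [v'], both terms that delete [w] vanish: in one, [v'] already follows [v]; in the
   other, [w] is not on a geodesic from [v'] to itself. *)
have [zv'|zv'] := eqVneq z v'.
  have /adjP[a ea _] := adj_v' wU vw wv'; have /adjP[b eb _] := wz.
  rewrite zv' eqxx; move: eb; rewrite zv' /smooth => eb.
  by rewrite dd ea eb /=; ring.
have -> : ohead (z :: t) != Some v' by apply: contra zv' => /eqP[->].
(* The distances from [v] to [w] and to [z] exceed those from [v'] by the same amount [d v v']. *)
suff -> : smooth v w z = smooth v' w z by ring.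
have /adjP[a ea vw0] := vw; have /adjP[b eb _] := wz.
have /adjP[c ec _] := vv'.
have := succ_v zU; rewrite eq_sym vz => /(_ isT) ez.
have := succ_v wU; rewrite eq_sym vw0 => /(_ isT).
rewrite /smooth ez ea eb ec {ez ea eb ec IH low ok}.
case: (d v' w) => [e [->]|]; last by move=> /= /eqP.
case: (d v' z) => [f|] /=; last by [].
have eS (m n : nat) : (Some m == Some n) = (m == n) by [].
by rewrite !eS -addSn -addnA eqn_add2l.
Qed.

Lemma valid_word_to s : valid U s -> word_to s.
Proof. by case/and4P; rewrite /word_to; case: s => //= u s -> -> _ ->. Qed.

(** Induction on the number of [v]: once [F - cobd h] vanishes on words with at most [j] of them,
    the homotopy formula makes it the coboundary of its [insert_succ] on words with at most
    [j.+1]. *)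
Lemma containing_acyclic k F :
    (forall s, valid U s -> size s = k.+1 -> cobd F s = 0) ->
    (forall s, valid U s -> size s = k -> v \notin s -> F s = 0) ->
  exists h, forall s, valid U s -> size s = k -> F s = cobd h s.
Proof.
move=> Fc F0.
suff [h hh] : exists h, forall s, valid U s -> size s = k ->
    (count_mem v s <= k)%N -> F s = cobd h s.
  by exists h => s vs sk; apply: hh => //; rewrite -sk count_size.
elim: {2}k => [|j [h hj]].
  exists (fun=> 0) => s vs sk; rewrite leqn0 => /eqP c.
  by rewrite cobd0 F0 //; apply/count_memPn.
(* Extended by zero, since [cobd_insert_succ] asks for vanishing on all words with fewer [v], valid
   or not. *)
pose G r := if valid U r && (size r == k) then F r - cobd h r else 0.
exists (fun r => 1 * h r + insert_succ G r) => s vs sk cs.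
rewrite cobd_lin mul1r.
have Gs : G s = F s - cobd h s by rewrite /G vs sk eqxx.
suff -> : cobd (insert_succ G) s = G s by rewrite Gs addrC subrK.
have G0 r : (count_mem v r <= j)%N -> G r = 0.
  by rewrite /G; case: ifP => // /andP[vr /eqP sr] cr; rewrite hj ?subrr.
have [vins|vins] := boolP (v \in s); last first.
  rewrite G0 ?(count_memPn vins) // -[RHS](cobd0 smooth s).
  apply: eq_in_cobd => r _ _ /mem_subseq sub.
  by apply: insert_succ_notin; apply: contra vins; apply: sub.
rewrite -[RHS]cobd_insert_succ ?valid_word_to //; last first.
  by move=> r cr; apply: G0; rewrite -ltnS (leq_trans cr).
rewrite -[LHS]addr0; congr (_ + _).
rewrite -[LHS](insert_succ0 s); apply: eq_in_insert_succ; first exact: valid_word_to.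
move=> r okr hr sr; have vr : valid U r.
  case/and3P: okr => wr Ur lr; case/and4P: vs => _ _ hs _.
  by rewrite /valid wr Ur hr hs /=; case: (r) sr lr.
rewrite (@eq_cobd_valid U _ (fun r => - 1 * cobd h r + F r)) //.
  by rewrite cobd_lin cobdK ?Fc ?sr ?sk ?mulr0 ?addr0 //; case/and4P: vr.
move=> q vq sq; rewrite /G vq mulN1r addrC ifT //=.
by rewrite -eqSS -sq sr sk.
Qed.

Lemma validD1 s : valid (U :\ v) s = valid U s && (v \notin s).
Proof.
have allD1 : all (mem (U :\ v)) s = all (mem U) s && (v \notin s).
  elim: s => //= a s ->; rewrite !inE negb_or eq_sym.
  by move: (v != a) (a \in U) (all _ s) (v \notin s) => [] [] [] [].
rewrite /valid allD1.
by move: (word s) (all _ s) (ohead s == _) (last x s == y) (v \notin s)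
  => [] [] [] [] [].
Qed.

(** A primitive [h1] of [m * F] on the words avoiding [v] makes [m * F - cobd h1] a cocycle that
    vanishes there, hence a coboundary by [containing_acyclic]. *)
Lemma torsion_bound_setD1 k m : torsion_bound k m (U :\ v) -> torsion_bound k m U.
Proof.
move=> t F h n n0 Fc Fh.
have [||h1 h1P] := t F h n n0.
- by move=> s; rewrite validD1 => /andP[vs _]; apply: Fc.
- by move=> s; rewrite validD1 => /andP[vs _]; apply: Fh.
have [||h2 h2P] := @containing_acyclic k (fun s => m * F s + (- 1) * cobd h1 s).
- move=> s vs sk; rewrite cobd_lin Fc // cobdZ cobdK ?mulr0 //.
  by case/and4P: vs.
- move=> s vs sk vins; rewrite h1P ?validD1 ?vs //.
  by rewrite mulN1r subrr.
exists (fun r => 1 * h1 r + h2 r) => s vs sk.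
by rewrite cobd_lin -h2P // mul1r mulN1r addrC subrK.
Qed.

End Insertion.

(** Distances remain those of the ambient space as [U] shrinks, so the condition refers to [d]
    rather than to walks inside [U]. *)
Definition removable (U U0 : {set V}) := forall v, v \in U -> v \notin U0 ->
  exists v', [/\ v' \in U, v' != v, v' != y, adj v v' &
    forall z, z \in U -> z != v -> d v z = add_option (d v v') (d v' z)].

(** Induction on the cardinality of [U]. When [v] is discarded, a vertex [w] with successor [v]
    takes over the successor [v'] of [v]. *)
Lemma torsion_bound_removable k m (U U0 : {set V}) :
  U0 \subset U -> y \in U0 -> (forall v, v \in U -> d v y) ->
  removable U U0 -> torsion_bound k m U0 -> torsion_bound k m U.
Proof.
move=> sU yU0 fin rem t0; move: {2}#|U| (leqnn #|U|) => c.
elim: c U sU fin rem => [|c IH] U sU fin rem cU.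
  by move: cU; rewrite leqn0 cards_eq0 => /eqP U_0; move: (subsetP sU _ yU0);
     rewrite U_0 inE.
have [sU0|] := boolP (U \subset U0).
  by have -> : U = U0 by apply/eqP; rewrite eqEsubset sU0.
case/subsetPn=> v vU vU0.
have [v' [v'U v'v v'y vv' sv]] := rem v vU vU0.
have vy : v != y by apply: contraNneq vU0 => ->.
apply: (torsion_bound_setD1 v'U v'v v'y vy vv' sv); apply: IH.
- by rewrite subsetD1 sU.
- by move=> z; rewrite inE => /andP[_]; apply: fin.
- move=> w; rewrite !inE => /andP[wv wU] wU0.
  have [w' [w'U w'w w'y ww' sw]] := rem w wU wU0.
  have [w'v|w'v] := eqVneq w' v; last first.
    exists w'; split=> //; first by rewrite !inE w'v.
    by move=> z; rewrite !inE => /andP[_]; apply: sw.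
  rewrite {}w'v in w'U w'w w'y ww' sw.
  have yU := subsetP sU _ yU0.
  have wy : w != y by apply: contraNneq wU0 => ->.
  have /adjP[a ea _] := ww'; have /adjP[b eb _] := vv'.
  (* Otherwise [w] and [v] would be each other's successor, and the finite distance [d w y] would
     exceed itself by the length of this cycle. *)
  have v'w : v' != w.
    apply/eqP => v'w; have := sw y yU; have := sv y yU.
    rewrite !(eq_sym y) wy vy => -> // /(_ isT).
    rewrite v'w in eb *; rewrite ea eb; case: (d w y) (fin w wU) => // e _ [] /eqP.
    by rewrite addnA -[X in X == _]add0n eqn_add2r.
  exists v'; split=> //.
  + by rewrite !inE v'v.
  + by rewrite /adj eq_sym v'w sw // ea eb.
  + move=> z; rewrite !inE => /andP[zv zU] zw.
    rewrite (sw z) // (sv z) // (sw v') // ea eb.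
    by case: (d v' z) => //= e; rewrite addnA.
- by move: cU; rewrite (cardsD1 v) vU.
Qed.

End Valid.

End Metric.

(** * Torsion bounds from the Smith normal form *)

(** The Smith normal form reduces to a diagonal matrix. There a torsion vector is zero in the rows
    without a nonzero diagonal entry, and in the others multiplication by the product of all nonzero
    entries makes it divisible by the diagonal entry. *)
Lemma coker_torsion p q (A : 'M[int]_(p, q)) :
  {m : int | m != 0 & forall (F : 'cV_p) (h : 'cV_q) (n : int), n != 0 ->
    n *: F = A *m h -> exists h', m *: F = A *m h'}.
Proof.
have [L Lu [R Ru [ds _ ->]]] := int_Smith_normal_form A.
set D := \matrix_(_, _) _.
exists (\prod_(x <- ds | x != 0) x).
  by elim/big_ind: _ => //; exact: mulf_neq0.
set m := \prod_(_ <- _ | _) _ => F h n n0 nF.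
have dsm i : ds`_i != 0 -> (m %/ ds`_i)%Z * ds`_i = m.
  move=> di; apply: divzK.
  have ids : ds`_i \in ds.
    by apply: mem_nth; case: ltnP di => // le; rewrite nth_default ?eqxx.
  by rewrite /m (big_rem _ ids) /= di dvdz_mulr.
pose G := invmx L *m F; pose K := R *m h.
have nG : n *: G = D *m K.
  by rewrite /G scalemxAr nF -!mulmxA mulKmx.
pose K' : 'cV[int]_q := \col_j oapp (fun i => (m %/ ds`_j)%Z * G i 0) 0 (insub (j : nat)).
suff mG : m *: G = D *m K'.
  exists (invmx R *m K'); rewrite -!mulmxA mulKVmx // -mG /G scalemxAr.
  by rewrite mulKVmx.
have DE (X : 'cV[int]_q) (i : 'I_p) (j : 'I_q) : i = j :> nat ->
    (D *m X) i 0 = ds`_i * X j 0.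
  move=> ij; rewrite mxE (bigD1 j) //= big1 ?addr0 => [|l lj].
    by rewrite mxE ij eqxx.
  rewrite mxE; case: eqP => [il|_]; last by rewrite mulr0n mul0r.
  by case/eqP: lj; apply: val_inj; rewrite /= -il.
have D0 (X : 'cV[int]_q) (i : 'I_p) : (q <= i)%N -> (D *m X) i 0 = 0.
  move=> qi; rewrite mxE big1 // => l _; rewrite mxE.
  by case: eqP => [il|_]; [move: (ltn_ord l); rewrite -il ltnNge qi | rewrite mulr0n mul0r].
apply/matrixP => i j; rewrite ord1 {j} mxE.
have := congr1 (fun X : 'cV[int]_p => X i 0) nG; rewrite mxE.
have [qi|iq] := leqP q i.
  by rewrite !D0 // => /eqP; rewrite mulf_eq0 (negPf n0) /= => /eqP ->; rewrite mulr0.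
rewrite !(DE _ _ (Ordinal iq)) //.
have [-> /eqP|di _] := eqVneq ds`_i 0.
  by rewrite !mul0r mulf_eq0 (negPf n0) /= => /eqP ->; rewrite mulr0.
have -> : K' (Ordinal iq) 0 = (m %/ ds`_i)%Z * G i 0 by rewrite mxE /= valK.
by rewrite mulrA [ds`_i * _]mulrC dsm.
Qed.

Lemma cobd_sum (T : eqType) smooth (I : Type) (e : seq I) (a : I -> int)
    (f : I -> seq T -> int) s :
  cobd smooth (fun r => \sum_(i <- e) a i * f i r) s =
  \sum_(i <- e) a i * cobd smooth (f i) s.
Proof.
elim: e => [|i e IH].
  by rewrite big_nil -[RHS](cobd0 smooth s); apply: eq_in_cobd => r _ _ _; rewrite big_nil.
rewrite big_cons -IH -cobd_lin.
by apply: eq_in_cobd => r _ _ _; rewrite big_cons.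
Qed.

Lemma cobd_map (S T : eqType) sm1 sm2 (f : S -> T) phi s :
  {in s & &, forall a b c, sm1 a b c = sm2 (f a) (f b) (f c)} ->
  cobd sm2 phi (map f s) = cobd sm1 (fun r => phi (map f r)) s.
Proof.
elim: s phi => [//|u [//|v [//|w t]]] IH phi e.
rewrite -/(map f) ![map f _]/= !cobdE -e ?inE ?eqxx ?orbT //.
rewrite -[f v :: f w :: _]/(map f [:: v, w & t]) (IH (fun r => phi (f u :: r))) //.
by move=> a b c ai bi ci; apply: e; rewrite inE ?ai ?bi ?ci orbT.
Qed.

Lemma cobd_torsion k M : exists2 m : int, m != 0 &
  forall (T : eqType) (smooth : T -> T -> T -> bool) (P : pred (seq T))
    (e : 'I_M -> T) (rk : T -> 'I_M),
    (forall s, P s -> {in s, cancel rk e}) ->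
  forall F h (n : int), n != 0 ->
    (forall s, P s -> size s = k.+1 -> n * F s = cobd smooth h s) ->
  exists h', forall s, P s -> size s = k.+1 -> m * F s = cobd smooth h' s.
Proof.
pose smI (c : {ffun 'I_M * 'I_M * 'I_M -> bool}) (x y z : 'I_M) := c (x, y, z).
pose ev (j : 'I_#|{: k.-tuple 'I_M}|) : seq 'I_M := tval (enum_val j).
(* Rows of words outside [Q] are zero; the columns run over all words of size [k], as [h] is
   unrestricted. *)
pose A c (Q : {set k.+1.-tuple 'I_M}) := \matrix_(i < #|{: k.+1.-tuple 'I_M}|,
  j < #|{: k.-tuple 'I_M}|) if enum_val i \in Q then
    cobd (smI c) (fun r => (r == ev j)%:R) (enum_val i) else 0.
pose m0 x := s2val (coker_torsion (A x.1 x.2)).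
exists (\prod_x m0 x).
  by elim/big_ind: _ => [//||x _]; [exact: mulf_neq0|rewrite /m0; case: coker_torsion].
move=> T smooth P e rk eK F h n n0 Fh.
pose c := [ffun x => smooth (e x.1.1) (e x.1.2) (e x.2)].
pose Q := [set t : k.+1.-tuple 'I_M | P (map e t)].
have cE g (t : k.+1.-tuple 'I_M) : t \in Q ->
    cobd smooth g (map e t) = cobd (smI c) (fun r => g (map e r)) t.
  by move=> _; apply: cobd_map => x y z _ _ _; rewrite /smI ffunE.
have AE (g : seq 'I_M -> int) (i : 'I_#|{: k.+1.-tuple 'I_M}|) : enum_val i \in Q ->
    (A c Q *m \col_j g (ev j)) i 0 = cobd (smI c) g (enum_val i).
  move=> iQ.
  transitivity (cobd (smI c) (fun r => \sum_j g (ev j) *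
      (r == ev j)%:R) (enum_val i)).
    by rewrite cobd_sum mxE; apply: eq_bigr => j _; rewrite !mxE iQ mulrC.
  apply: eq_in_cobd => r _; rewrite size_tuple => -[/esym/eqP sr] _.
  rewrite (bigD1 (enum_rank (Tuple sr))) //= /ev enum_rankK eqxx mulr1 big1 ?addr0 //.
  move=> j jr; case: eqP => [rj|_]; last by rewrite mulr0.
  by case/eqP: jr; rewrite -[j]enum_valK; congr enum_rank; apply: val_inj.
have [h' hh'] : exists h', forall t, t \in Q ->
    m0 (c, Q) * F (map e t) = cobd (smI c) h' t.
  rewrite /m0 /=; case: coker_torsion => m m_n0 /= H.
  have [|h' hh'] := H (\col_i if enum_val i \in Q then F (map e (enum_val i)) else 0)
     (\col_j h (map e (ev j))) n n0.
    apply/colP => i; rewrite mxE [in LHS]mxE.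
    case: ifP => iQ; last first.
      by rewrite mulr0 !mxE big1 // => j _; rewrite !mxE iQ mul0r.
    rewrite (AE (fun r => h (map e r))) // -cE // Fh ?size_map ?size_tuple //.
    by move: iQ; rewrite inE.
  pose g (r : seq 'I_M) :=
    oapp (fun t : k.-tuple 'I_M => h' (enum_rank t) 0) 0 (insub r).
  exists g => t tQ; have := congr1 (fun X : 'cV[int]__ => X (enum_rank t) 0) hh'.
  rewrite !mxE enum_rankK tQ => ->.
  rewrite -[in RHS](enum_rankK t) -AE ?enum_rankK // mxE; apply: eq_bigr => j _.
  by rewrite !mxE /g /ev valK /= enum_valK.
(* The bounds of the other pairs are absorbed in the primitive, which [rk] carries back to words in
   [T]. *)
exists (fun r => (\prod_(x | x != (c, Q)) m0 x) * h' (map rk r)) => s Ps ss.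
have sk : size (map rk s) == k.+1 by rewrite size_map ss.
have es : map e (map rk s) = s.
  by rewrite -map_comp -[RHS]map_id; apply/eq_in_map => a /(eK _ Ps).
rewrite (bigD1 (c, Q)) //= [m0 _ * _]mulrC -mulrA cobdZ; congr (_ * _).
have tQ : Tuple sk \in Q by rewrite inE /= es.
have := hh' _ tQ; rewrite /= es => ->.
apply: cobd_map => x y z xs ys zs.
by rewrite /smI ffunE /= !(eK _ Ps).
Qed.

(** * Directed distance and the genus *)

Section Dist.
Variable G : quiver.
Implicit Types (u v w x y : vert G) (e : edge G) (p : seq (edge G)).

Lemma dpath_cat u v w p q : dpath u p v -> dpath v q w -> dpath u (p ++ q) w.
Proof.
by elim: p u => [|e p IH] u /=; [move/eqP-> | case/andP=> -> /IH h /h ->].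
Qed.

Lemma dpath_rcons u w p e : dpath u (rcons p e) w = dpath u p (src e) && (tgt e == w).
Proof.
by elim: p u => [|a p IH] u /=; rewrite ?IH -?andbA // eq_sym.
Qed.

Lemma has_dpathP v w n :
  reflect (exists2 p, size p = n & dpath v p w) (has_dpath v w n).
Proof.
apply: (iffP existsP) => [[p vpw]|[p pn vpw]]; first by exists p; rewrite ?size_tuple.
by move/eqP: pn => pn; exists (Tuple pn).
Qed.

Variant dist_spec v w : option nat -> Prop :=
| DistSome p of dpath v p w & (forall q, dpath v q w -> size p <= size q)%N :
    dist_spec v w (Some (size p))
| DistNone of (forall p, ~~ dpath v p w) : dist_spec v w None.

Lemma distP v w : dist_spec v w (dist v w).
Proof.
rewrite /dist; case: pselect => [vw|nvw].
  case: ex_minnP => n /has_dpathP[p <- vpw] pmin; constructor=> // q vqw.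
  by apply/pmin/has_dpathP; exists q.
constructor=> p; apply/negP => vpw; apply: nvw; exists (size p).
by apply/has_dpathP; exists p.
Qed.

Lemma dist_dpath v w p : dpath v p w -> exists2 n, dist v w = Some n & (n <= size p)%N.
Proof.
by move=> vpw; case: distP => [q _ /(_ p vpw)|/(_ p)]; [exists (size q) | rewrite vpw].
Qed.

Lemma dist_refl v : dist v v = Some 0%N.
Proof. by have [|n -> ] := @dist_dpath v v [::]; rewrite //= leqn0 => /eqP->. Qed.

Lemma dist_eq0 v w : dist v w = Some 0%N -> v = w.
Proof. by case: distP => // -[|e p] //= /eqP. Qed.

Lemma dist_triangle u v w a b : dist u v = Some a -> dist v w = Some b ->
  exists2 c, dist u w = Some c & (c <= a + b)%N.
Proof.
case: (distP u v) => // p up _ [<-]; case: (distP v w) => // q vq _ [<-].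
by rewrite -size_cat; apply: dist_dpath; apply: dpath_cat vq.
Qed.

Lemma dist_edge e : exists2 n, dist (src e) (tgt e) = Some n & (n <= 1)%N.
Proof. by apply: (@dist_dpath _ _ [:: e]); rewrite /= !eqxx. Qed.

Lemma dist_first v w n : dist v w = Some n.+1 ->
  exists2 e, src e = v & dist (tgt e) w = Some n.
Proof.
case: distP => // -[//|e p] /= /andP[/eqP ev epw] pmin [<-]; exists e => //.
have [m em mp] := dist_dpath epw; rewrite em; congr Some.
apply/eqP; rewrite eqn_leq mp; move: em; case: distP => // q eqw _ [<-].
by have := pmin (e :: q); rewrite /= ev eqxx => /(_ eqw).
Qed.

Lemma dist_last v w n : dist v w = Some n.+1 ->
  exists2 e, tgt e = w & dist v (src e) = Some n.
Proof.
case: distP => // p; case/lastP: p => [//|p e].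
rewrite dpath_rcons size_rcons => /andP[vpe /eqP ew] pmin [<-]; exists e => //.
have [m em mp] := dist_dpath vpe; rewrite em; congr Some.
apply/eqP; rewrite eqn_leq mp; move: em; case: distP => // q vqe _ [<-].
by have := pmin (rcons q e); rewrite dpath_rcons size_rcons ew eqxx vqe => /(_ isT).
Qed.

Definition inner_edges (W : {set vert G}) : {set edge G} :=
  [set e | (src e \in W) && (tgt e \in W)].

(** Rank-nullity for [boundary] on the span of the inner edges: the image lies in the span of the
    vertices of [W], the kernel in the first homology. *)
Lemma card_inner_edges W : (#|inner_edges W| <= #|W| + genus G)%N.
Proof.
set E := inner_edges W.
pose X := [tuple fbasis rat (enum_val i) | i < #|E|].
pose S := <<X>>%VS.
have dimS : \dim S = #|E|.
  suff /eqP : free X by rewrite size_tuple.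
  apply/freeP => k k0 i.
  have := congr1 (fun f : freemod rat (edge G) => f (enum_val i)) k0.
  rewrite sum_ffunE ffunE (bigD1 i) //= big1 => [|j ji].
    by rewrite addr0 (nth_map i) ?size_enum_ord // !ffunE nth_ord_enum eqxx [_ *: _]mulr1.
  rewrite (nth_map i) ?size_enum_ord // !ffunE nth_ord_enum.
  rewrite (inj_eq enum_val_inj) eq_sym (negPf ji); exact: mulr0.
have dimB : (\dim (boundary G @: S) <= #|W|)%N.
  pose Y := [tuple fbasis rat (enum_val i) | i < #|W|].
  have inY v : v \in W -> fbasis rat v \in <<Y>>%VS.
    move=> vW; apply: memv_span; apply/mapP; exists (enum_rank_in vW v).
      by rewrite mem_enum.
    by rewrite enum_rankK_in.
  have := dim_span Y; rewrite size_tuple; apply: leq_trans.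
  apply: dimvS; rewrite limg_span; apply/span_subvP => _ /mapP[_ /mapP[i _ ->] ->].
  have := enum_valP i; rewrite inE => /andP[sW tW].
  by rewrite lfunE /= flinear_fbasis memvB ?inY.
rewrite -dimS -(limg_ker_dim (boundary G) S) addnC leq_add //.
by apply: dimvS; apply: capvSr.
Qed.

End Dist.

(** * Vertices on directed walks between two endpoints *)

Section Between.
Variables (G : quiver) (x y : vert G).

Definition between : {set vert G} := [set w | dist x w && dist w y].
Local Notation W := between.
Local Notation E := (inner_edges W).
Definition inner_out w : {set edge G} := [set e in E | src e == w].
Definition inner_in w : {set edge G} := [set e in E | tgt e == w].

(** The vertices to be discarded. Edges to [y] are excluded because the homotopy needs a successor
    that is not the last letter. *)
Definition passing : {set vert G} :=
  [set w in W | [&& w != y, #|inner_out w| == 1%N & [forall e in inner_out w, tgt e != y]]].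

Lemma betweenP w : reflect (exists a b, dist x w = Some a /\ dist w y = Some b) (w \in W).
Proof.
rewrite inE; apply: (iffP andP) => [[]|[a [b [-> ->]]]] //.
by case: (dist x w) => // a _; case: (dist w y) => // b _; exists a, b.
Qed.

Lemma dist_trans (u v w : vert G) : dist u v -> dist v w -> dist u w.
Proof.
case uv: (dist u v) => [a|] // _; case vw: (dist v w) => [b|] // _.
by have [c -> _] := dist_triangle uv vw.
Qed.

Lemma between_out w z n : w \in W -> z \in W -> dist w z = Some n.+1 ->
  exists2 e, e \in inner_out w & dist (tgt e) z = Some n.
Proof.
rewrite !inE => /andP[xw wy] /andP[xz zy] wz.
have [e ew ez] := dist_first wz; exists e => //.
have [m wt _] := dist_edge e; rewrite ew in wt.
rewrite !inE ew eqxx xw wy !andbT /=; apply/andP; split.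
  by apply: (dist_trans xw); rewrite wt.
by apply: dist_trans zy; rewrite ez.
Qed.

Lemma inner_out_gt0 w : w \in W -> w != y -> (0 < #|inner_out w|)%N.
Proof.
move=> wW wy; have /betweenP[a [[|b] [xw ey]]] := wW.
  by rewrite (dist_eq0 ey) eqxx in wy.
have yW : y \in W by apply/betweenP; have [c xy _] := dist_triangle xw ey;
  exists c, 0%N; rewrite dist_refl.
by have [e eo _] := between_out wW yW ey; apply/card_gt0P; exists e.
Qed.

Lemma inner_in_gt0 w : w \in W -> w != x -> (0 < #|inner_in w|)%N.
Proof.
move=> wW wx; have /betweenP[[|a] [b [ex wy]]] := wW.
  by rewrite (dist_eq0 ex) eqxx in wx.
have [e ew xe] := dist_last ex; apply/card_gt0P; exists e.
have [m st _] := dist_edge e; rewrite ew in st.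
move: wW; rewrite !inE ew eqxx => /andP[-> ywb]; rewrite ywb xe !andbT /=.
by apply: dist_trans ywb; rewrite st.
Qed.

(** The remaining vertices are [y], those with several outgoing inner edges, and sources of inner
    edges into [y]. Counting inner edges by source and by target against [card_inner_edges] bounds
    the last two kinds by the genus plus 1 and plus 2. *)
Lemma card_between_rest : (#|W :\: passing| <= (genus G + genus G) + 4)%N.
Proof.
have cE := card_inner_edges W.
pose B := [set w in W | (w != y) && (1 < #|inner_out w|)%N].
have cB : (#|B| <= (genus G).+1)%N.
  (* Each vertex of [W] other than [y] has an outgoing inner edge, and those in [B] have a second
     one. *)
  have : (#|B| + #|W :\ y| <= #|E|)%N.
    have -> : #|E| = (\sum_(w in W) #|inner_out w|)%N.
      rewrite -sum1_card (partition_big (@src G) (mem W)) /=; last first.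
        by move=> e; rewrite inE => /andP[].
      by apply: eq_bigr => w _; rewrite -sum1_card; apply: eq_bigl => e; rewrite !inE.
    rewrite -!sum1_card [X in (X + _)%N]big_mkcond [X in (_ + X)%N]big_mkcond.
    rewrite -big_split [X in (_ <= X)%N]big_mkcond; apply: leq_sum => w _ /=.
    rewrite [w \in B]inE in_setD1.
    case: (boolP (w \in W)) => //= wW; last by rewrite andbF.
    case: (boolP (w != y)) => //= wy; have := inner_out_gt0 wW wy.
    by case: ifP => [|_].
  have := cardsD1 y W; move: cE; case: (y \in W) => /= cE cW h;
    by move: cE cW h; clear; lia.
have cI : (#|inner_in y| <= (genus G).+2)%N.
  (* Besides the edges into [y], each vertex of [W] other than [x] and [y] receives an inner
     edge. *)
  have : (#|inner_in y| + #|W :\ y :\ x| <= #|E|)%N.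
    have [yW|yW] := boolP (y \in W); last first.
      have W0 : W = set0.
        apply/setP => w; rewrite [in RHS]inE; apply/negP => /betweenP[a [b [xw wy]]].
        case/negP: yW; apply/betweenP; have [c xy _] := dist_triangle xw wy.
        by exists c, 0%N; rewrite dist_refl.
      have -> : inner_in y = set0.
        by apply/setP => e; rewrite !inE; apply/negP => /andP[/andP[_ ty] /eqP te];
           move: yW; rewrite -te inE ty.
      by rewrite !cards0 W0 !set0D cards0.
    have -> : #|E| = (\sum_(w in W) #|inner_in w|)%N.
      rewrite -sum1_card (partition_big (@tgt G) (mem W)) /=; last first.
        by move=> e; rewrite inE => /andP[].
      by apply: eq_bigr => w _; rewrite -sum1_card; apply: eq_bigl => e; rewrite !inE.
    rewrite (bigD1 y yW) /= leq_add2l -sum1_card.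
    rewrite big_mkcond [X in (_ <= X)%N]big_mkcond; apply: leq_sum => w _ /=.
    rewrite !in_setD1; case: (boolP (w \in W)) => //= wW; rewrite ?andbF //.
    case: (boolP (w != x)) => //= wx; case: (w != y) => //=.
    by rewrite ifT; [exact: inner_in_gt0 | rewrite andbT; exact: wW].
  have := cardsD1 y W; have := cardsD1 x (W :\ y).
  move: cE; case: (y \in W); case: (x \in _) => /= cE h1 h2 h3;
    by move: cE h1 h2 h3; clear; lia.
have sub : W :\: passing \subset [set y] :|: B :|: (@src G @: inner_in y).
  apply/subsetP => w; rewrite in_setD [in w \in passing]inE => /andP[np wW].
  rewrite !in_setU in_set1; have [//|wy] := eqVneq w y.
  have := inner_out_gt0 wW wy; rewrite leq_eqVlt => /orP[/eqP w1|w2]; last first.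
    by rewrite [w \in B]inE wW wy w2.
  move: np; rewrite wW wy -w1 eqxx /= negb_forall => /existsP[e].
  rewrite negb_imply negbK => /andP[eo te].
  apply/orP; right; apply/imsetP; exists e.
    by move: eo; rewrite !inE te => /andP[->].
  by move: eo; rewrite inE => /andP[_ /eqP].
apply: leq_trans (subset_leq_card sub) _.
apply: leq_trans (leq_card_setU _ _) _.
have c1 := leq_card_setU [set y] B; rewrite cards1 in c1.
have c2 := leq_imset_card (@src G) (inner_in y).
apply: leq_trans (leq_add (leq_trans c1 (leq_add (leqnn 1) cB)) (leq_trans c2 cI)) _.
by clear; lia.
Qed.

(** The successor is the target of the only inner edge out of [v]: every shortest path from [v] to
    another vertex of [W] starts with an inner edge. *)
Lemma removable_passing : removable (@dist G) y W (W :\: passing).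
Proof.
move=> v vW; rewrite in_setD vW andbT negbK => vp.
move: (vp); rewrite inE => /and4P[_ vy /cards1P[e oe] /forall_inP ey].
have eo : e \in inner_out v by rewrite oe set11.
have/betweenP[a [[|b] [xv evy]]] := vW; first by rewrite (dist_eq0 evy) eqxx in vy.
have yW : y \in W by apply/betweenP; have [c xy _] := dist_triangle xv evy;
  exists c, 0%N; rewrite dist_refl.
have step z n : z \in W -> dist v z = Some n.+1 -> dist (tgt e) z = Some n.
  by move=> zW vz; have [e'] := between_out vW zW vz; rewrite oe => /set1P->.
have sv : src e = v by move: eo; rewrite inE => /andP[_ /eqP].
(* A loop at [v] would put [v] one step closer to [y] than itself. *)
have tv : tgt e != v.
  by apply/eqP => tv; have := step _ _ yW evy; rewrite tv evy => -[]; lia.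
have dve : dist v (tgt e) = Some 1%N.
  have [[|[|m]]] := dist_edge e; rewrite sv // => /dist_eq0 vt.
  by rewrite vt eqxx in tv.
exists (tgt e); split=> //; last 2 first.
- by rewrite /adj eq_sym tv dve.
- move=> z zW zv; rewrite dve; case vz: (dist v z) => [[|n]|].
  + by rewrite (dist_eq0 vz) eqxx in zv.
  + by rewrite (step z n).
  + case tz: (dist (tgt e) z) => [c|] //=.
    by have [c' ] := dist_triangle dve tz; rewrite vz.
- by move: eo; rewrite !inE => /andP[/andP[_ /andP[-> ->]]].
- exact: ey.
Qed.

End Between.

(** * A torsion bound uniform in the quiver *)

Section Words.
Variable G : quiver.
Local Notation d := (@dist G).
Local Notation word s := (sorted (adj d) s).
Local Notation cobd := (cobd (smooth d)).

Lemma word_between (u : vert G) s : word (u :: s) ->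
  all (mem (between u (last u s))) (u :: s).
Proof.
elim: s u => [|v s IH] u ws; first by rewrite /= andbT inE dist_refl.
have [uv /IH vs] : adj d u v /\ word (v :: s) by apply/andP.
have /andP[_ duv] := uv.
apply/allP => w; rewrite inE => /orP[/eqP-> | ws'].
  rewrite !inE dist_refl /=; move/allP: vs => /(_ v (mem_head _ _)).
  by rewrite !inE => /andP[_ h]; apply: dist_trans duv h.
move/allP: vs => /(_ w ws'); rewrite !inE => /andP[vw ->]; rewrite andbT.
exact: dist_trans duv vw.
Qed.

End Words.

(** [cobd] preserves both endpoints, so the problem splits over the pairs of endpoints; the same
    bound works for each after the passing vertices are discarded. *)
Lemma quiver_torsion k g : exists2 m : int, m != 0 &
  forall G : quiver, (genus G <= g)%N ->
  forall F h (n : int), n != 0 ->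
    (forall s, sorted (adj (@dist G)) s -> size s = k.+2 ->
      cobd (smooth (@dist G)) F s = 0) ->
    (forall s, sorted (adj (@dist G)) s -> size s = k.+1 ->
      n * F s = cobd (smooth (@dist G)) h s) ->
  exists h', forall s, sorted (adj (@dist G)) s -> size s = k.+1 ->
    m * F s = cobd (smooth (@dist G)) h' s.
Proof.
have [m m0 mP] := cobd_torsion k (g + g + 4).+1; exists m => // G gG F h n n0 Fc Fh.
have [H HP] : exists H : vert G * vert G -> seq (vert G) -> int, forall xy s,
    valid (@dist G) xy.1 xy.2 (between xy.1 xy.2) s -> size s = k.+1 ->
    m * F s = cobd (smooth (@dist G)) (H xy) s.
  suff /choice[H HP] : forall xy : vert G * vert G, exists h', forall s,
      valid (@dist G) xy.1 xy.2 (between xy.1 xy.2) s -> size s = k.+1 ->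
      m * F s = cobd (smooth (@dist G)) h' s by exists H.
  move=> [x y] /=.
  suff t : torsion_bound (@dist G) x y k.+1 m (between x y).
    by apply: (t F h n n0) => s /and4P[ws _ _ _]; [exact: Fc | exact: Fh].
  (* If [y] cannot be reached from [x], there are no valid words. *)
  have [yW|yW] := boolP (y \in between x y); last first.
    move=> ? h' ? ? _ _; exists h' => -[|a s] /and4P[_ /allP sW _ /eqP ly] _ //.
    by case/negP: yW; move: (sW _ (mem_last a s)); rewrite (ly : last a s = y).
  pose U0 := between x y :\: passing x y.
  apply: (@torsion_bound_removable _ _ (@dist_eq0 G) (@dist_refl G)
    (@dist_triangle G) _ _ _ _ _ U0).
  - exact: subsetDl.
  - by rewrite in_setD yW [y \in passing _ _]inE eqxx andbF.
  - by move=> v; rewrite inE => /andP[].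
  - exact: removable_passing.
  move=> F' h' n' n0' _ F'h'.
  have cU : (#|U0| < (g + g + 4).+1)%N.
    rewrite ltnS; apply: leq_trans (card_between_rest x y) _.
    by rewrite leq_add2r leq_add.
  pose e (i : 'I_(g + g + 4).+1) := nth y (enum U0) i.
  pose rk v : 'I_(g + g + 4).+1 := inord (index v (enum U0)).
  apply: (mP _ _ (valid (@dist G) x y U0) e rk _ F' h' n' n0' F'h') => s vs v sv.
  have vU : v \in enum U0 by rewrite mem_enum; case/and4P: vs => _ /allP /(_ v sv).
  rewrite /e /rk inordK ?nth_index //.
  by apply: leq_ltn_trans cU; rewrite cardE index_size.
(* The endpoints of the word select the primitive. *)
exists (fun r => if r is a :: q then H (a, last a q) r else 0) => -[//|a s] ws ss.
have va : valid (@dist G) a (last a s) (between a (last a s)) (a :: s).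
  by rewrite /valid ws word_between //= !eqxx.
rewrite (HP (a, last a s)) //; apply: (eq_cobd_valid (@dist_eq0 G) (@dist_refl G) va).
by move=> [|b r] /and4P[_ _ /eqP // [->] /eqP /= ->].
Qed.

(* No face is discarded here, as for the sums defining [mdiff]. *)
Local Notation full_cobd := (cobd (fun _ _ _ => true)).

Lemma cobd_faces (T : eqType) (phi : seq T -> int) n s : size s = n.+2 ->
  full_cobd phi s =
  \sum_(i < n) (-1) ^+ i.+1 * phi (take i.+1 s ++ drop i.+2 s).
Proof.
elim: n s phi => [|n IH] [|u [|v s]] // phi.
  by case: s => //; rewrite big_ord0 cobd2.
case: s => [//|w t] [st]; rewrite cobdE (IH [:: v, w & t]) /= ?st //.
rewrite big_ord_recl /= expr1 mulN1r mul1r -sumrN; congr (_ + _).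
by apply: eq_bigr => i _; rewrite /bump leq0n add1n /= [(-1) ^+ i.+2]exprS mulN1r mulNr.
Qed.

(** * Magnitude cochains as functions on words *)

Section Translation.
Variable G : quiver.
Local Notation d := (@dist G).
Local Notation word s := (sorted (adj d) s).
Local Notation cobd := (cobd (smooth d)).

Fixpoint wlength (s : seq (vert G)) : nat :=
  if s is u :: s1 then
    if s1 is v :: _ then (odflt 0 (d u v) + wlength s1)%N else 0%N
  else 0%N.

Lemma wlengthE k (x : k.+1.-tuple (vert G)) : mlength x = wlength x.
Proof.
rewrite /mlength; case: x => -[//|u s] /= us.
pose f i := odflt 0%N (d (nth u (u :: s) i) (nth u (u :: s) i.+1)).
transitivity (\sum_(i < k) f i)%N.
  by apply: eq_bigr => i _; rewrite !(tnth_nth u) /= .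
have {us} <- : size s = k by apply/eqP.
rewrite {}/f; elim: s {2 4 5}u => [|v s IH] w; first by rewrite big_ord0.
by rewrite big_ord_recl; congr (_ + _)%N; apply: IH.
Qed.

Lemma admissibleE k (x : k.+1.-tuple (vert G)) : admissible x = word x.
Proof.
case: x => -[//|u s] us; have sk : size s = k by apply/eqP.
apply/forallP/(sortedP u) => /= [h i|h i].
  rewrite sk ltnS => ik; have := h (Ordinal ik).
  by rewrite !(tnth_nth u).
by have := h i; rewrite sk ltnS ltn_ord !(tnth_nth u) => /(_ isT).
Qed.

Lemma omitE k (i : 'I_k.+2) (x : k.+2.-tuple (vert G)) :
  omit i x = take i x ++ drop i.+1 x :> seq _.
Proof.
have x0 := tnth x ord0.
have ik := ltn_ord i.
have sti : size (take i x) = i by rewrite size_takel // size_tuple ltnW.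
apply: (@eq_from_nth _ x0) => [|j].
  by rewrite size_tuple size_cat sti size_drop size_tuple subSS subnKC.
rewrite size_tuple => jk.
rewrite -[j]/(val (Ordinal jk)) -tnth_nth tnth_mktuple (tnth_nth x0) /= /bump.
rewrite nth_cat sti; case: ltnP => ij; first by rewrite nth_take.
by rewrite nth_drop addSn subnKC.
Qed.

(** Matches [smooth] with the test by which [mface] keeps a face. When it holds, [d u w] is
    positive, so [u] and [w] differ. *)
Lemma smooth_word u v w t : word [:: u, v, w & t] ->
  smooth d u v w = word [:: u, w & t] &&
    (wlength [:: u, w & t] == wlength [:: u, v, w & t]).
Proof.
move=> /= /and3P[uv vw wt].
have [a ea _] := adjP (@dist_eq0 G) uv; have [b eb _] := adjP (@dist_eq0 G) vw.
have [c ec _] := dist_triangle ea eb.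
rewrite wt andbT addnA eqn_add2r /smooth /adj ea eb ec /= andbT.
rewrite -[Some c == _]/(c == _); case: eqP => [cE|_]; last by rewrite andbF.
rewrite andbT; apply/esym/eqP => uw; move: ec; rewrite uw dist_refl cE.
by case; rewrite addSn.
Qed.

Lemma wlength_cons u s r : ohead r = ohead s -> s != [::] ->
  (wlength (u :: r) == wlength (u :: s)) = (wlength r == wlength s).
Proof. by case: s r => [|a s] [|_ r] // [->] _ /=; rewrite eqn_add2l. Qed.

(** Brings in the grading: [cobd] treats words of all lengths at once, but relates only words of
    equal length. *)
Lemma cobd_wlength phi s : word s -> cobd phi s =
  full_cobd
    (fun r => if word r && (wlength r == wlength s) then phi r else 0) s.
Proof.
elim: s phi => [//|u [//|v [//|w t]]] IH phi ws.
have /andP[uv ws1] : adj d u v && word [:: v, w & t] := ws.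
rewrite !cobdE mul1r (smooth_word ws) (IH (fun r => phi (u :: r)) ws1).
congr (- _ - _); first by case: ifP; rewrite ?mul1r ?mul0r.
apply: eq_in_cobd => -[//|a r] [av] _ _.
by rewrite av (@wlength_cons u [:: v, w & t] (v :: r)) //= uv.
Qed.

Lemma eq_cobd_wlength phi psi s : word s ->
    (forall r, word r -> wlength r = wlength s -> size s = (size r).+1 ->
      phi r = psi r) ->
  cobd phi s = cobd psi s.
Proof.
move=> ws e; rewrite !cobd_wlength //; apply: eq_in_cobd => r _ sr _.
by case: ifP => // /andP[wr /eqP lr]; apply: e.
Qed.

Section Length.
Variables k l : nat.

(** Extension by zero turns a cochain into a function to which [cobd] applies. *)
Definition seq_cochain (h : cochain G k l) (s : seq (vert G)) : int :=
  oapp (fun x : mtuple G k l => h (fbasis int x)) 0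
    (obind insub (insub s : option (k.+1.-tuple (vert G)))).

Definition cochain_of (h : seq (vert G) -> int) : cochain G k l :=
  linfun (flinear (fun x : mtuple G k l => h (val x) : int^o)).

Lemma mtupleP (s : seq (vert G)) : word s -> wlength s = l -> size s = k.+1 ->
  exists x : mtuple G k l, s = val x.
Proof.
move=> ws ls /eqP ss.
have h : admissible (Tuple ss) && (mlength (Tuple ss) == l).
  by rewrite admissibleE wlengthE ws ls eqxx.
by exists (Sub (Tuple ss) h).
Qed.

Lemma word_mtuple (x : mtuple G k l) : word (val x).
Proof. by have /andP[] := valP x; rewrite admissibleE. Qed.

Lemma wlength_mtuple (x : mtuple G k l) : wlength (val x) = l.
Proof. by have /andP[_ /eqP] := valP x; rewrite wlengthE. Qed.

Lemma seq_cochain_val h (x : mtuple G k l) : seq_cochain h (val x) = h (fbasis int x).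
Proof. by rewrite /seq_cochain valK /= valK. Qed.

Lemma seq_cochain_out h s : wlength s != l -> seq_cochain h s = 0.
Proof.
rewrite /seq_cochain; case: insubP => //= t _ <-; case: insubP => //= x _ <-.
by rewrite wlength_mtuple eqxx.
Qed.

Lemma seq_cochain_of h (x : mtuple G k l) : seq_cochain (cochain_of h) (val x) = h (val x).
Proof. by rewrite seq_cochain_val lfunE /= flinear_fbasis. Qed.

Lemma eq_cochain (f h : cochain G k l) :
  (forall x, f (fbasis int x) = h (fbasis int x)) -> f = h.
Proof.
move=> fh; apply/lfunP => c.
have -> : c = \sum_x c x *: fbasis int x.
  apply/ffunP => x; rewrite sum_ffunE (bigD1 x) //= big1 => [|y yx].
    by rewrite !ffunE eqxx addr0; apply/esym/mulr1.
  by rewrite !ffunE eq_sym (negPf yx); apply: mulr0.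
by rewrite !linear_sum; apply: eq_bigr => x _; rewrite !linearZ /= fh.
Qed.

(** Named in order to carry an additive structure, so that [raddfMz] moves integer multiples through
    evaluation. *)
Definition cochain_eval u (f : cochain G k l) : int^o := f u.
Lemma cochain_eval_is_zmod_morphism u : zmod_morphism (cochain_eval u).
Proof. by move=> f h; rewrite /cochain_eval add_lfunE opp_lfunE. Qed.
HB.instance Definition _ u :=
  GRing.isZmodMorphism.Build _ _ (cochain_eval u) (cochain_eval_is_zmod_morphism u).

End Length.

Lemma codiff_fbasis k l (h : cochain G k l) (x : mtuple G k.+1 l) :
  codiff h (fbasis int x) = cobd (seq_cochain h) (val x).
Proof.
rewrite /codiff comp_lfunE lfunE /= flinear_fbasis linear_sum.
rewrite cobd_wlength ?word_mtuple // (@cobd_faces _ _ k) ?size_tuple //.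
(* The end indices [0] and [k.+1], excluded in [mdiff], are split off; the inner ones match those of
   [cobd_faces], shifted by one. *)
rewrite big_mkcond big_ord_recl big_ord_recr /= add0r ltnn addr0.
apply: eq_bigr => i _; rewrite /= ltnS ltn_ord linearZ /=; congr (_ * _).
rewrite -(omitE (lift ord0 (widen_ord (leqnSn k) i))).
set y := omit _ _; rewrite -admissibleE wlength_mtuple -wlengthE.
rewrite /seq_cochain /mface valK /=.
by case: insubP => [z -> _|/negPf->]; rewrite ?linear0.
Qed.

End Translation.

(** * Passage to cohomology and to the direct sum *)

Definition coord (M : nat -> zmodType) l (x : dsum M) : M l := (x : dprod M) l.

Lemma coord_is_zmod_morphism (M : nat -> zmodType) l :
  zmod_morphism (@coord M l).
Proof. by []. Qed.

HB.instance Definition _ (M : nat -> zmodType) l :=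
  GRing.isZmodMorphism.Build (dsum M) (M l) (@coord M l)
    (@coord_is_zmod_morphism M l).

Lemma quot_MHl_eq0 G k l (f : cocycles G k l) (n : int) :
  (\pi_(MHl G k l) f *~ n == 0) = `[< is_coboundary (val f *~ n) >].
Proof.
rewrite -raddfMz -(raddf0 \pi_(MHl G k l)) -Quotient.idealrBE subr0.
rewrite unfold_in /coboundary; congr (`[< is_coboundary _ >]).
by rewrite -[LHS]/(val _) raddfMz.
Qed.

Theorem corollary5p5 (k g : nat) :
  exists2 m : int, m != 0 &
    forall G : quiver, (genus G <= g)%N ->
      forall x : MH G k, torsion x -> x *~ m = 0.
Proof.
have [m m0 mP] : exists2 m : int, m != 0 & forall G : quiver, (genus G <= g)%N ->
    forall l (f : cocycles G k l) n, n != 0 ->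
    is_coboundary (val f *~ n) -> is_coboundary (val f *~ m).
  case: k => [|k].
    (* In degree 0 a torsion class is a cochain with a zero multiple, and integer valued cochains
       have no torsion. *)
    exists 1 => // G _ l f n n0 /= fn; apply: eq_cochain => x.
    have := congr1 (cochain_eval (fbasis int x)) fn; rewrite !raddfMz raddf0.
    move=> /eqP; rewrite mulrz_eq0 (negPf n0) /= => /eqP h.
    by rewrite mulr1z -[LHS]/(cochain_eval _ _) h lfunE.
  have [m m0 mP] := quiver_torsion k.+1 g; exists m => // G gG l [f fP] n n0 /= [h fh].
  have [s ws ss|s ws ss|h' h'P] := mP G gG (seq_cochain f) (seq_cochain h) n n0.
  (* On words of length other than [l] everything vanishes, because of the extension by zero. *)
  - have [ls|ls] := eqVneq (wlength s) l; last first.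
      rewrite -(cobd0 (smooth (@dist G)) s); apply: eq_cobd_wlength => // r _ lr _.
      by rewrite seq_cochain_out ?lr.
    have [x ->] := mtupleP ws ls ss; rewrite -codiff_fbasis.
    by move: fP; rewrite unfold_in => /eqP->; rewrite lfunE.
  - have [ls|ls] := eqVneq (wlength s) l; last first.
      rewrite seq_cochain_out // mulr0 -(cobd0 (smooth (@dist G)) s).
      apply: eq_cobd_wlength => // r _ lr _.
      by rewrite seq_cochain_out ?lr.
    have [x ->] := mtupleP ws ls ss; rewrite -codiff_fbasis seq_cochain_val -fh.
    by rewrite -[RHS]/(cochain_eval _ _) raddfMz -mulrzl [n%:~R]intz.
  exists (cochain_of k l h'); apply: eq_cochain => x.
  rewrite codiff_fbasis -[LHS]/(cochain_eval _ _) raddfMz.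
  transitivity (m * f (fbasis int x)); first by rewrite -mulrzl [m%:~R]intz.
  rewrite -seq_cochain_val h'P ?word_mtuple ?size_tuple //.
  apply: eq_cobd_wlength => [|r wr lr]; first exact: word_mtuple.
  rewrite size_tuple wlength_mtuple in lr * => -[/esym sr].
  by have [z ->] := mtupleP wr lr sr; rewrite seq_cochain_of.
exists m => // G gG x [n n0 xn].
(* As [m] does not depend on [l], the claim can be checked in each coordinate. *)
apply: val_inj; apply: functional_extensionality_dep => l.
have cM c : coord l (x *~ c) = coord l x *~ c by exact: raddfMz.
have [f fx] : exists f : cocycles G k l, coord l x = \pi_(MHl G k l) f.
  by exists (repr (coord l x)); rewrite reprK.
rewrite -[LHS]/(coord l _) cM fx; apply/eqP; rewrite quot_MHl_eq0; apply/asboolP.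
apply: (mP _ gG _ _ _ n0); apply/asboolP; rewrite -quot_MHl_eq0 -fx -cM xn.
by apply/eqP; apply: raddf0.
Qed.
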